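(* For every integer $n\ge4$, there exists a nontrivial cubic totally silver graph of order $4n$.
   Context: A totally silver coloring of a graph $G$ is a map $c$ from $V(G)$ to a set of colors such that for every $v\in V(G)$, each color appears exactly once on the closed neighborhood $N[v]$; a graph is totally silver if it admits one. Cubic means $3$--regular. A cubic totally silver graph is called nontrivial if it is $3$--connected and has girth at least $6$. *)

(* Defs.v *)
From mathcomp Require Import all_boot.

Set Implicit Arguments.
Unset Strict Implicit.
Unset Printing Implicit Defensive.

Record sgraph := SGraph {
  vertex :> finType;
  adj : rel vertex;
  adj_sym : symmetric adj;
  adj_irrefl : irreflexive adj
}.

Section Graphs.
Variable G : sgraph.
Implicit Types (u v : G) (S : {set G}).

Definition open_nbhd v : {set G} := [set u | adj v u].

Definition closed_nbhd v : {set G} := v |: open_nbhd v.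

Definition regular (k : nat) : Prop := forall v, #|open_nbhd v| = k.

Definition cubic : Prop := regular 3.

Definition totally_silver_coloring (C : Type) (c : G -> C) : Prop :=
  forall v (k : C), exists! u, u \in closed_nbhd v /\ c u = k.

Definition totally_silver : Prop :=
  exists (C : Type) (c : G -> C), totally_silver_coloring c.

(* Adjacency in the graph obtained from G by deleting the vertices in S. *)
Definition adj_minus S : rel G :=
  [rel u v | [&& u \notin S, v \notin S & adj u v]].

Definition connected_minus S : Prop :=
  forall u v, u \notin S -> v \notin S -> connect (adj_minus S) u v.

Definition k_connected (k : nat) : Prop :=
  k < #|G| /\ forall S, #|S| < k -> connected_minus S.

(* The bound on the size is needed because adj is symmetric, so that
   [:: u; v] is a ucycle whenever u and v are adjacent. *)
Definition graph_cycle (p : seq G) : Prop := 2 < size p /\ ucycle (@adj G) p.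

(* Girth is the least length of a cycle (infinite for a forest). *)
Definition girth_at_least (g : nat) : Prop :=
  forall p, graph_cycle p -> g <= size p.

Definition nontrivial_cubic_totally_silver : Prop :=
  [/\ cubic, totally_silver, k_connected 3 & girth_at_least 6].

End Graphs.

(* Main.v *)
Require Import Defs.
From mathcomp Require Import all_boot ssralg zmodp.

Set Implicit Arguments.
Unset Strict Implicit.
Unset Printing Implicit Defensive.

Import GRing.Theory.

(** The graph consists of [n] claws arranged cyclically, one for each level in
    [Z/n]; the leaf [i : Z/3] at level [x] is joined to the leaf [i + 1] at
    level [x + 1].  Colouring a vertex by its position in the claw is totally
    silver.  Three consecutive vertices of a cycle then have distinct colours,
    so with only four colours there is no 5-cycle, and a 3-cycle or a 4-cycle
    would force [1], [2] or [3] to vanish in [Z/n].  For 3-connectivity, the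
    leaves form three disjoint strands running through all levels, and two
    deleted vertices leave one strand intact; at most two levels are damaged,
    so every surviving leaf lies at, or is adjacent to, an undamaged level. *)

(** * Local constraints of a totally silver colouring *)

Section SilverColorings.
Variables (G : sgraph) (C : Type) (c : G -> C).
Hypothesis silver : totally_silver_coloring c.

Lemma silver_inj v u w :
  u \in closed_nbhd v -> w \in closed_nbhd v -> c u = c w -> u = w.
Proof.
move=> uv wv cuw; have [t [_ uniq_t]] := silver v (c w).
by rewrite -(uniq_t u) // -(uniq_t w).
Qed.

Lemma silver_adj u v : adj u v -> c u <> c v.
Proof.
move=> uv cuv; have := @silver_inj u u v.
rewrite /closed_nbhd setU11 !inE uv orbT => /(_ isT isT cuv) euv.
by rewrite euv adj_irrefl in uv.
Qed.

Lemma silver_path2 u v w : adj u v -> adj v w -> u != w -> c u <> c w.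
Proof.
move=> uv vw /eqP neq cuw; apply: neq; apply: (@silver_inj v) => //.
  by rewrite !inE (adj_sym v) uv orbT.
by rewrite !inE vw orbT.
Qed.

End SilverColorings.

(** Any two vertices of a 5-cycle are adjacent or have a common neighbour on it, so five distinct
    colours would be needed. *)
Lemma silver4_no_cycle5 (G : sgraph) (C : finType) (c : G -> C) (p : seq G) :
  totally_silver_coloring c -> #|C| = 4 -> size p = 5 -> ~ ucycle (@adj G) p.
Proof.
move=> silver card_C; case: p => [|a [|b [|d [|e [|f [|]]]]]] // _.
move=> /andP[/= /and5P[ab bd de ef /andP[fa _]]].
rewrite !inE !negb_or.
move=> /and5P[/and4P[_ nad nae _] /and3P[_ nbe nbf] /andP[_ ndf] _ _].
have adjN := silver_adj silver; have pathN := silver_path2 silver.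
have : uniq [seq c x | x <- [:: a; b; d; e; f]].
  rewrite /= !inE !negb_or.
  do ![apply/andP; split] => //; apply/eqP; try exact: adjN.
  - exact: pathN ab bd nad.
  - by apply/nesym/(pathN _ _ _ ef fa); rewrite eq_sym.
  - by apply/nesym/adjN.
  - exact: pathN bd de nbe.
  - by apply/nesym/(pathN _ _ _ fa ab); rewrite eq_sym.
  - exact: pathN de ef ndf.
by move/card_uniqP => cardp; have := max_card [in map c [:: a; b; d; e; f]];
  rewrite cardp card_C.
Qed.

Lemma connect_minus_sym (G : sgraph) (S : {set G}) :
  connect_sym (adj_minus S).
Proof. by apply: sym_connect_sym => u v; rewrite /adj_minus /= adj_sym andbCA. Qed.

(** * The cyclic arrangement of claws: degree, colouring, girth *)

Section TwistedClaws.
Local Open Scope ring_scope.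
Variable k : nat.
Local Notation level := 'I_k.+4.

Local Notation claw_vertex := (level * option 'I_3)%type.

(* [(x, None)] is the centre of the claw at level [x]. *)
Definition claw_adj : rel claw_vertex := fun u v =>
  match u, v with
  | (x, None), (y, Some _) | (x, Some _), (y, None) => x == y
  | (x, Some i), (y, Some j) =>
      (y == x + 1) && (j == i + 1) || (x == y + 1) && (i == j + 1)
  | _, _ => false
  end.

(** Having at least four levels matters here: 1, 2 and 3 stay below the modulus. *)
Lemma level_natr_neq0 m : (0 < m < 4)%N -> m%:R != 0 :> level.
Proof.
case/andP=> m_gt0 m_lt4; rewrite -val_eqE /= (@val_Zp_nat k.+4) //.
by rewrite modn_small -?lt0n // (leq_trans m_lt4).
Qed.

Lemma level_addn_neq m (x : level) : (0 < m < 4)%N -> x + m%:R <> x.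
Proof.
by move=> /level_natr_neq0/eqP nz /(canRL (addKr x)); rewrite addNr.
Qed.

Lemma leaf_succ_neq (i : 'I_3) : (i == i + 1) = false.
Proof. by case: i => -[|[|[]]]. Qed.

Lemma claw_adj_sym : symmetric claw_adj.
Proof. by move=> [x [i|]] [y [j|]] //=; rewrite 1?orbC // eq_sym. Qed.

Lemma claw_adj_irrefl : irreflexive claw_adj.
Proof. by move=> [x [i|]] //=; rewrite leaf_succ_neq !andbF. Qed.

Definition claw_graph : sgraph := SGraph claw_adj_sym claw_adj_irrefl.

Lemma card_claw_graph : #|claw_graph| = (4 * k.+4)%N.
Proof. by rewrite card_prod card_option !card_ord mulnC. Qed.

Lemma claw_nbhd_center x :
  open_nbhd ((x, None) : claw_graph) = [set (x, Some i) | i : 'I_3].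
Proof.
apply/setP => -[y [j|]]; rewrite inE /=; apply/idP/imsetP => //.
- by move/eqP<-; exists j.
- by case=> i _ [-> _].
- by case.
Qed.

Lemma claw_nbhd_leaf x i : open_nbhd ((x, Some i) : claw_graph) =
  [set (x, None); (x + 1, Some (i + 1)); (x - 1, Some (i - 1))].
Proof.
apply/setP => -[y [j|]]; rewrite !inE /= !xpair_eqE /=; last first.
  by rewrite !andbF !orbF andbT eq_sym.
by rewrite andbF /= !(inj_eq Some_inj) !(eq_sym _ (_ - 1)) !subr_eq.
Qed.

Lemma claw_cubic : cubic claw_graph.
Proof.
case=> x [i|]; last first.
  by rewrite claw_nbhd_center card_imset ?card_ord // => ? ? [].
rewrite claw_nbhd_leaf -setUA !cardsU1 cards1 !inE !xpair_eqE !andbF /=.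
by case: i => -[|[|[]]] // p; rewrite andbF.
Qed.

(** A centre sees one leaf of each index; a leaf [i] sees its centre and leaves [i + 1] and [i - 1],
    which together with [i] exhaust Z/3. *)
Lemma claw_silver : totally_silver_coloring (snd : claw_graph -> _).
Proof.
move=> [x [i|]] l; last first.
  exists (x, l); split; first by case: l => [i|]; rewrite !inE /= ?eqxx ?orbT.
  case=> y j [] /[swap] /= ->; rewrite !inE /= => /orP[/eqP[-> ->]|] //.
  by case: l => //= i /eqP ->.
rewrite /closed_nbhd claw_nbhd_leaf.
have [-> | [-> | [-> | ->]]] :
  l = None \/ l = Some i \/ l = Some (i + 1) \/ l = Some (i - 1).
- case: l => [j|]; last by left.
  suff: [|| j == i, j == i + 1 | j == i - 1] by case/or3P => /eqP->; auto.
  by case: i j => -[|[|[]]] // p [[|[|[]]]].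
- exists (x, None); split; first by rewrite !inE eqxx ?orbT.
  case=> y j [] /[swap] /= ->; rewrite !inE !xpair_eqE.
  by rewrite !andbF !orbF andbT /= => /eqP ->.
- exists (x, Some i); split; first by rewrite !inE eqxx ?orbT.
  case=> y j [] /[swap] /= ->; rewrite !inE !xpair_eqE !(inj_eq Some_inj) eqxx.
  have -> : (i == i - 1) = false by case: i => -[|[|[]]].
  by rewrite leaf_succ_neq !andbF !orbF andbT => /eqP ->.
- exists (x + 1, Some (i + 1)); split; first by rewrite !inE eqxx ?orbT.
  case=> y j [] /[swap] /= ->; rewrite !inE !xpair_eqE !(inj_eq Some_inj) eqxx.
  have -> : (i + 1 == i) = false by rewrite eq_sym leaf_succ_neq.
  have -> : (i + 1 == i - 1) = false by case: i => -[|[|[]]].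
  by rewrite !andbF !orbF andbT => /eqP ->.
- exists (x - 1, Some (i - 1)); split; first by rewrite !inE eqxx ?orbT.
  case=> y j [] /[swap] /= ->; rewrite !inE !xpair_eqE !(inj_eq Some_inj) eqxx.
  have -> : (i - 1 == i) = false by rewrite subr_eq leaf_succ_neq.
  have -> : (i - 1 == i + 1) = false by case: i => -[|[|[]]].
  by rewrite !andbF !orbF andbT => /eqP ->.
Qed.

(* The distance travelled in the levels along an edge depends only on the
   colours of its ends. *)
Definition level_shift (a b : option 'I_3) : level :=
  if a isn't Some i then 0 else if b isn't Some j then 0 else
  if j == i + 1 then 1 else - 1.

Lemma claw_adj_shift (u v : claw_graph) :
  adj u v -> v.1 = u.1 + level_shift u.2 v.2.
Proof.
case: u v => [x [i|]] [y [j|]] //=; rewrite /level_shift ?addr0.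
- case/orP=> /andP[/eqP-> /eqP->]; first by rewrite eqxx.
  (* Here the edge descends from index [j + 1] to [j]; passing the test for shift 1 would mean
     [j = j + 2] in Z/3. *)
  by case: ifP => [|_]; rewrite ?addrK //; case: j => -[|[|[]]].
- by move=> /eqP.
- by move=> /eqP.
Qed.

(** Three leaf colours are met in steps of one sign, with total 3 or -3; if the centre colour
    occurs, a single leaf-to-leaf step remains, with total 1 or -1. *)
Lemma level_shift3_neq0 a b c : uniq [:: a; b; c] ->
  level_shift a b + level_shift b c + level_shift c a != 0.
Proof.
have N1 := @level_natr_neq0 1%N isT; have N3 := @level_natr_neq0 3%N isT.
have E3 : 1 + 1 + 1 = 3%:R :> level by rewrite -!addrA.
move: a b c => [[[|[|[]]] // p]|] [[[|[|[]]] // q]|] [[[|[|[]]] // r]|] //= _.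
all: rewrite /level_shift /= ?addr0 ?add0r ?oppr_eq0 -?opprD ?oppr_eq0 ?E3 //.
Qed.

(** All four colours occur, so exactly two steps join leaf colours, and both have the same sign: the
    total is 2 or -2. *)
Lemma level_shift4_neq0 a b c d : uniq [:: a; b; c; d] ->
  level_shift a b + level_shift b c + level_shift c d + level_shift d a != 0.
Proof.
have N2 := @level_natr_neq0 2%N isT.
have E2 : 1 + 1 = 2%:R :> level by [].
move: a b c d => [[[|[|[]]] // p]|] [[[|[|[]]] // q]|] [[[|[|[]]] // r]|]
  [[[|[|[]]] // s]|] //= _.
all: rewrite /level_shift /= ?addr0 ?add0r ?oppr_eq0 -?opprD ?oppr_eq0 ?E2 //.
Qed.

Lemma claw_girth : girth_at_least claw_graph 6.
Proof.
move=> p [p_gt2 p_cycle]; rewrite leqNgt; apply/negP => p_lt6.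
have adjN := silver_adj claw_silver; have pathN := silver_path2 claw_silver.
have [p3 | p4 | p5] : [\/ size p = 3, size p = 4 | size p = 5].
- by move: (size p) p_gt2 p_lt6 => [|[|[|[|[|[]]]]]] // _ _; constructor.
- case: p p_cycle p3 {p_gt2 p_lt6} => [|u [|v [|w []]]] //.
  case/andP=> /= /and4P[uv vw wu _] _ _.
  have /eqP[] : level_shift u.2 v.2 + level_shift v.2 w.2
                + level_shift w.2 u.2 != 0.
    apply: level_shift3_neq0; rewrite /= !inE !negb_or.
    by do ![apply/andP; split] => //; apply/eqP; try apply/adjN;
      rewrite // adj_sym.
  (* Adding the shifts to [u.1] edge by edge leads round the cycle back to [u.1], so they sum to
     0. *)
  apply: (addrI u.1); rewrite addr0 !addrA -!claw_adj_shift //.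
- case: p p_cycle p4 {p_gt2 p_lt6} => [|u [|v [|w [|t []]]]] //.
  case/andP=> /= /and5P[uv vw wt tu _].
  rewrite !inE !negb_or => /and4P[/and3P[_ uw _] /andP[_ vt] _ _] _.
  have /eqP[] : level_shift u.2 v.2 + level_shift v.2 w.2
                + level_shift w.2 t.2 + level_shift t.2 u.2 != 0.
    apply: level_shift4_neq0; rewrite /= !inE !negb_or.
    do ![apply/andP; split] => //; apply/eqP; try by apply/adjN.
    + exact: pathN uv vw uw.
    + by apply/nesym/adjN.
    + exact: pathN vw wt vt.
  apply: (addrI u.1); rewrite addr0 !addrA -!claw_adj_shift //.
- apply: (silver4_no_cycle5 claw_silver _ p5 p_cycle).
  by rewrite card_option card_ord.
Qed.

(** * Connectivity after deleting at most two vertices *)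

Section Deletion.
Variable S : {set claw_graph}.
Hypothesis S_le2 : (#|S| < 3)%N.

Local Notation linked := (connect (adj_minus S)).

(* Numbering the strands so that leaf [i] at level [x] lies on strand [i];
   the value on centres is irrelevant. *)
Definition strand_index (x : level) (u : claw_graph) : 'I_3 :=
  odflt 0 u.2 - (u.1 - x)%R%:R.

Definition clean (x : level) : bool := [forall a, (x, a) \notin S].

Lemma cleanP x : reflect (forall a, (x, a) \notin S) (clean x).
Proof. exact: forallP. Qed.

(** Pigeonhole: [f @: S] has at most two elements. It is applied to levels, strands and leaf
    indices. *)
Lemma avoid_S (T : finType) (f : claw_graph -> T) (A : {set T}) :
  (2 < #|A|)%N -> exists2 t, t \in A & forall u, f u = t -> u \notin S.
Proof.
move=> A_gt2; have /subsetPn[t tA tS] : ~~ (A \subset f @: S).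
  apply/negP => /subset_leq_card; apply/negP; rewrite -ltnNge.
  by apply: leq_ltn_trans (leq_imset_card _ _) _; apply: leq_trans A_gt2.
exists t => // u fu; apply: contra tS => uS; rewrite -fu; exact: imset_f.
Qed.

Lemma clean_in (A : {set level}) : (2 < #|A|)%N -> exists2 x, x \in A & clean x.
Proof.
move=> /(avoid_S fst)[x xA xS]; exists x => //.
by apply/cleanP => a; apply: xS.
Qed.

Lemma linked_adj u v : u \notin S -> v \notin S -> adj u v -> linked u v.
Proof. by move=> uS vS uv; apply: connect1; apply/and3P. Qed.

Lemma linked_claw x i : (x, None) \notin S -> (x, Some i) \notin S ->
  linked (x, None) (x, Some i).
Proof. by move=> cS lS; apply: linked_adj; rewrite //= eqxx. Qed.

(** Some strand avoids [S]; following it upwards from level [x] reaches level [y]. Strands start at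
    [x] and are not closed up, so the number of levels may be any residue mod 3. *)
Lemma linked_clean x y : clean x -> clean y -> linked (x, None) (y, None).
Proof.
move=> /cleanP xS /cleanP yS.
have [|i _ iS] := @avoid_S _ (strand_index x) setT; first by rewrite cardsT card_ord.
pose strand m : claw_graph := (x + m%:R, Some (i + m%:R)).
have strandS m : (m < k.+4)%N -> strand m \notin S.
  move=> m_lt; apply: iS.
  (* The level offset is reduced modulo the number of levels before being cast to Z/3; [m_lt]
     ensures that it is still [m]. *)
  change (i + m%:R - (x + m%:R - x)%R%:R = i); rewrite [x + _]addrC addrK.
  by rewrite (@val_Zp_nat k.+4) // modn_small // addrK.
have link m : (m < k.+4)%N -> linked (strand 0) (strand m).
  elim: m => [|m IHm] m_lt; first exact: connect0.
  apply: connect_trans (IHm (ltnW m_lt)) _.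
  apply: linked_adj; rewrite ?strandS // 1?ltnW //=.
  by rewrite -!addrA !natr1 !eqxx.
(* The natural number representing [y - x] is the number of steps from [x] up to [y]. *)
have eq_y : strand (y - x)%R = (y, Some (i + (y - x)%R%:R)).
  by rewrite /strand natr_Zp addrCA subrr addr0.
have := link (y - x)%R (ltn_ord _); rewrite eq_y /strand !addr0 => xy.
apply: connect_trans (linked_claw (xS _) (xS (Some i))) _.
by apply: connect_trans xy _; rewrite connect_minus_sym linked_claw.
Qed.

(** The leaf and its two leaf neighbours lie on three distinct levels, at most two of which meet
    [S]. *)
Lemma linked_leaf_clean (x : level) i : (x, Some i) \notin S ->
  exists2 y, clean y & linked (x, Some i) (y, None).
Proof.
move=> xS; have [|y] := @clean_in [set x; x + 1; x - 1].
  have N1 (y : level) : (y == y + 1) = false.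
    by apply/negbTE/eqP=> /esym/(@level_addn_neq 1 y isT).
  have N2 : (x + 1 == x - 1) = false.
    rewrite eq_sym subr_eq -addrA.
    by apply/negbTE/eqP=> /esym/(@level_addn_neq 2 x isT).
  by rewrite -setUA !cardsU1 cards1 !inE N1 N2 eq_sym subr_eq N1.
rewrite !inE -orbA => /or3P[] /eqP-> clean_y.
- exists x => //; rewrite connect_minus_sym linked_claw //; exact: (cleanP _ clean_y).
- exists (x + 1) => //; have yS := cleanP _ clean_y.
  apply: (@connect_trans claw_graph _ (x + 1, Some (i + 1))); last first.
    by rewrite connect_minus_sym linked_claw.
  by rewrite linked_adj //= !eqxx.
- exists (x - 1) => //; have yS := cleanP _ clean_y.
  apply: (@connect_trans claw_graph _ (x - 1, Some (i - 1))); last first.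
    by rewrite connect_minus_sym linked_claw.
  by rewrite linked_adj //= !subrK !eqxx orbT.
Qed.

Lemma linked_to_clean u : u \notin S -> exists2 y, clean y & linked u (y, None).
Proof.
case: u => x [i|] xS; first exact: linked_leaf_clean.
(* Some leaf index is spared by [S] entirely, hence also in this claw. Centres are counted under
   index 0, which is harmless since there are still three classes. *)
have [|i _ iS] := @avoid_S _ (fun u => odflt 0 u.2) setT.
  by rewrite cardsT card_ord.
have leafS : (x, Some i) \notin S by apply: iS.
have [y clean_y link] := linked_leaf_clean leafS; exists y => //.
exact: connect_trans (linked_claw xS leafS) link.
Qed.

Lemma claw_connected_minus : connected_minus S.
Proof.
move=> u v /linked_to_clean[x clean_x ux] /linked_to_clean[y clean_y vy].
apply: connect_trans ux _; apply: connect_trans (linked_clean clean_x clean_y) _.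
by rewrite connect_minus_sym.
Qed.

End Deletion.

Lemma claw_nontrivial : nontrivial_cubic_totally_silver claw_graph.
Proof.
split; [exact: claw_cubic | | | exact: claw_girth].
- by exists (option 'I_3), snd; apply: claw_silver.
- split=> [|S]; last exact: claw_connected_minus.
  by rewrite card_claw_graph.
Qed.

End TwistedClaws.

Theorem theorem4p2 (n : nat) (hn : 4 <= n) :
  exists G : sgraph, #|G| = 4 * n /\ nontrivial_cubic_totally_silver G.
Proof.
case: n hn => [|[|[|[|k]]]] // _; exists (claw_graph k).
split; [exact: card_claw_graph | exact: claw_nontrivial].
Qed.
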